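(* Let $n \ge 5$ and let $f$ be a nice mechanism for the two-facility game on the real line with $n$ agents. Then for every location profile $\mathbf{x} = (x_1,\dots,x_n) \in \mathbb{R}^n$, writing $f(\mathbf{x}) = \{l_1, l_2\}$, at least one of the following holds: there exists $l \in f(\mathbf{x})$ with $l \ge \max \mathbf{x}$ or $l \le \min \mathbf{x}$; or $l_1 = l_2$.
   Context: Two-facility game on a line: there are $n$ agents $N=\{1,\dots,n\}$, agent $i$ having location $x_i \in \mathbb{R}$; a location profile is $\mathbf{x}=(x_1,\dots,x_n)$, with $\min\mathbf{x}$ and $\max\mathbf{x}$ the smallest and largest coordinates. A deterministic mechanism is a function $f$ mapping each reported profile $\mathbf{x}\in\mathbb{R}^n$ to a pair of facility locations $f(\mathbf{x})=\{l_1,l_2\}$ (possibly $l_1=l_2$). The cost of an agent at $y$ is $\mathrm{cost}(\{l_1,l_2\},y)=\min\{|l_1-y|,|l_2-y|\}$. The social cost is $SC(f,\mathbf{x})=\sum_{i=1}^n \mathrm{cost}(f(\mathbf{x}),x_i)$, and $OPT(\mathbf{x})=\min_{l_1,l_2\in\mathbb{R}}\sum_{i}\mathrm{cost}(\{l_1,l_2\},x_i)$. The mechanism $f$ is strategy-proof if for every agent $i$, every profile $\mathbf{x}=\langle x_i,\mathbf{x}_{-i}\rangle$ and every $x_i'\in\mathbb{R}$, $\mathrm{cost}(f(x_i,\mathbf{x}_{-i}),x_i)\le \mathrm{cost}(f(x_i',\mathbf{x}_{-i}),x_i)$. It has bounded approximation ratio if there is a finite $\gamma$ with $SC(f,\mathbf{x})\le\gamma\,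 OPT(\mathbf{x})$ for all $\mathbf{x}$. A mechanism is nice if it is deterministic, strategy-proof, and has bounded approximation ratio. *)

(* Defs.v *)
From HB Require Import structures.
From mathcomp Require Import all_boot all_order all_algebra.
From mathcomp Require Import reals.
Set Implicit Arguments. Unset Strict Implicit. Unset Printing Implicit Defensive.
Import Order.TTheory GRing.Theory Num.Theory.
Local Open Scope ring_scope.

Section TwoFacility.
Variables (R : realType) (n : nat).

Definition profile := 'I_n -> R.

(* a deterministic mechanism outputs two facility locations (l1, l2);
   the output is read as the (multi)set {l1, l2} *)
Definition mechanism := profile -> R * R.

Definition cost (l : R * R) (y : R) : R := Num.min `|l.1 - y| `|l.2 - y|.

Definition SC (f : mechanism) (x : profile) : R := \sum_(i < n) cost (f x) (x i).

Definition SC_loc (l : R * R) (x : profile) : R := \sum_(i < n) cost l (x i).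

Definition upd (x : profile) (i : 'I_n) (xi' : R) : profile :=
  fun j => if j == i then xi' else x j.

Definition strategy_proof (f : mechanism) : Prop :=
  forall (i : 'I_n) (x : profile) (xi' : R),
    cost (f x) (x i) <= cost (f (upd x i xi')) (x i).

(* OPT(x) is the minimum of SC_loc over all pairs; SC <= gamma * OPT(x)
   is written out as SC <= gamma * SC_loc l x for every pair l (the minimum is attained). *)
Definition bounded_approx (f : mechanism) : Prop :=
  exists gamma : R, forall (x : profile) (l : R * R), SC f x <= gamma * SC_loc l x.

Definition nice (f : mechanism) : Prop := strategy_proof f /\ bounded_approx f.

Definition loc_ge_max (x : profile) (l : R) : Prop := forall i, x i <= l.
Definition loc_le_min (x : profile) (l : R) : Prop := forall i, l <= x i.

End TwoFacility.

Arguments cost {R} l y.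
Arguments SC {R n} f x.
Arguments SC_loc {R n} l x.
Arguments upd {R n} x i xi'.
Arguments strategy_proof {R n} f.
Arguments bounded_approx {R n} f.
Arguments nice {R n} f.
Arguments loc_ge_max {R n} x l.
Arguments loc_le_min {R n} x l.

(* Main.v *)
(* Say that P, Q are unblocked when some profile has P at one point, Q at one point
   to its right, and a facility strictly between.  Gathering the other agents at that
   facility keeps it there, so this is a property of three-agent mechanisms.  From the
   image sets of single reports one gets two facts about coalitions.
   (1) Adjacent orders: for a partition P, Y, Q, not both (P, Q) and (Y, Q) are
       unblocked, nor both (P, Q) and (P, Y).
   (2) Extension: for a partition A, B, D, Z with (A, Z) unblocked, one of (A + B, Z),
       (A, D + Z), (B, Z) is unblocked; symmetrically with (A, D) as third case.
   For n >= 5 these combine, purely combinatorially, into: if ({i}, {k}) is unblocked,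
   then so are (N - j - k, {k}) and ({i}, N - i - j) for some agent j.  If now f(x)
   has facilities l1 < l2 with x_i < l1 and l2 < x_k, such a j exists, and (1) is violated
   by ({j}, {k}) when x_j < l2 and by ({i}, {j}) when l2 <= x_j. *)

From mathcomp Require Import boolp classical_sets.
Require Import Defs.
From HB Require Import structures.
From mathcomp Require Import all_boot all_order all_algebra.
From mathcomp Require Import reals zify lra.
Import Order.TTheory GRing.Theory Num.Theory.
Local Open Scope ring_scope.
Set Implicit Arguments.
Unset Strict Implicit.
Unset Printing Implicit Defensive.

(** * Image sets of a single report *)

Section OneParameter.
Variable R : realType.
Implicit Types (y : R * R) (phi : R -> R * R).

Definition on y (l : R) : bool := (l == y.1) || (l == y.2).

Lemma cost_fac y p : exists2 l, on y l & cost y p = `|l - p|.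
Proof.
rewrite /cost /on /Num.min; case: ifP => _.
  by exists y.1; rewrite ?eqxx.
by exists y.2; rewrite ?eqxx ?orbT.
Qed.

Lemma cost_le y p l : on y l -> cost y p <= `|l - p|.
Proof.
by rewrite /on /cost ge_min => /orP[] /eqP ->; rewrite lexx ?orbT.
Qed.

Lemma cost_ge0 y p : 0 <= cost y p.
Proof. by have [l _ ->] := cost_fac y p. Qed.

Lemma cost_near y p d : cost y p <= d -> exists2 l, on y l & p - d <= l <= p + d.
Proof.
have [l yl ->] := cost_fac y p; rewrite ler_norml => /andP[? ?].
by exists l => //; apply/andP; split; lra.
Qed.

Lemma near_cost y p d l : on y l -> p - d <= l <= p + d -> cost y p <= d.
Proof.
move=> /(cost_le p) h /andP[? ?]; apply: le_trans h _.
by rewrite ler_norml; apply/andP; split; lra.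
Qed.

Lemma on3 y l1 l2 l3 : on y l1 -> on y l2 -> on y l3 -> l1 < l2 -> l1 < l3 ->
  l2 = l3.
Proof.
by rewrite /on => /orP[]/eqP-> /orP[]/eqP-> /orP[]/eqP->; rewrite ?ltxx.
Qed.

Definition truthful phi := forall t s, cost (phi t) t <= cost (phi s) t.

(** The attained points act as a menu: an agent at [p] could report [s], so reporting [p] gets it a
    facility at least as near. *)
Lemma truthful_near phi s p d l : truthful phi -> on (phi s) l ->
  p - d <= l <= p + d -> exists2 l', on (phi p) l' & p - d <= l' <= p + d.
Proof. move=> T yl h; apply: cost_near; exact: le_trans (T p s) (near_cost yl h). Qed.

Lemma truthful_on phi s l : truthful phi -> on (phi s) l -> on (phi l) l.
Proof.
move=> T yl; have [|l' y' /andP[? ?]] := truthful_near (p := l) (d := 0) T yl.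
  by apply/andP; split; lra.
have E : l' = l by lra.
by rewrite E in y'.
Qed.

(* The hole of the image of [phi] around the unserved point [q] starts at an
   attained point [u], and [u] serves the reports just above it. *)
Lemma hole_left phi w0 w q (eps : R) : truthful phi -> on (phi w0) w -> w < q ->
  ~~ on (phi q) q -> 0 < eps ->
  exists u s, [/\ w <= u, u < s, s < q, s < u + eps & on (phi s) u].
Proof.
move=> T /(truthful_on T) ww wq nq e0.
pose I : set R := fun t => (t <= q) && on (phi t) t.
have Iw : I w by rewrite /I ww andbT ltW.
have supI : has_sup I.
  by split; [exists w | exists q => t /andP[? _]].
set u := sup I.
have wu : w <= u by apply: (sup_upper_bound supI).
have uq : u <= q by apply: ge_sup => [|t /andP[]//]; exists w.
(* The supremum is attained: otherwise an attained point close enough below [u] would be a better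
   misreport for [u]. *)
have Iu : on (phi u) u.
  have [l yl E] := cost_fac (phi u) u.
  suff : `|l - u| <= 0 by rewrite normr_le0 subr_eq0 => /eqP lu; rewrite lu in yl.
  rewrite leNgt; apply/negP => l0.
  have [t /andP[tq tt] ut] := sup_adherent l0 supI.
  have tu : t <= u by apply: (sup_upper_bound supI); rewrite /I tq.
  have := le_trans (T u t) (cost_le u tt); rewrite E => h.
  have : `|t - u| < `|l - u| by rewrite [ltLHS]ler0_norm; rewrite -/u in ut; lra.
  by rewrite ltNge h.
have {uq}uq : u < q.
  by rewrite lt_neqAle uq andbT; apply: contraNneq nq => <-.
(* With a third, [2 * s - u] stays below [q], so the facility within [s - u] of [s] belongs to [I]
   and must be [u]. *)
pose s := u + Num.min eps (q - u) / 3.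
have m0 : 0 < Num.min eps (q - u) by rewrite lt_min e0 subr_gt0.
have [m1 m2] : Num.min eps (q - u) <= eps /\ Num.min eps (q - u) <= q - u.
  by rewrite !ge_min !lexx orbT.
have [|l' yl' /andP[h1 h2]] := truthful_near (p := s) (d := s - u) T Iu.
  by rewrite /s; apply/andP; split; lra.
have l'u : l' = u.
  apply/eqP; rewrite eq_le; apply/andP; split; last by lra.
  apply: (sup_upper_bound supI); rewrite /I (truthful_on T yl') andbT.
  by move: h2; rewrite /s; lra.
rewrite l'u in yl'; exists u, s; split=> //; rewrite /s; lra.
Qed.

Definition oppp y : R * R := (- y.1, - y.2).

Lemma on_opp y l : on (oppp y) l = on y (- l).
Proof. by rewrite /on /= -!eqr_oppLR. Qed.

Lemma cost_opp y p : cost (oppp y) p = cost y (- p).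
Proof.
by rewrite /cost /= -!opprD !normrN !opprK.
Qed.

Lemma truthful_opp phi : truthful phi -> truthful (fun t => oppp (phi (- t))).
Proof. by move=> T t s; rewrite !cost_opp; apply: T. Qed.

Lemma hole_right phi w0 w q (eps : R) : truthful phi -> on (phi w0) w -> q < w ->
  ~~ on (phi q) q -> 0 < eps ->
  exists u s, [/\ u <= w, s < u, q < s, u < s + eps & on (phi s) u].
Proof.
move=> T ww wq nq e0.
have [||||u [s [h1 h2 h3 h4 h5]]] :=
  @hole_left _ (- w0) (- w) (- q) eps (truthful_opp T).
- by rewrite on_opp !opprK.
- by rewrite ltrN2.
- by rewrite on_opp !opprK.
- by [].
by exists (- u), (- s); rewrite -on_opp; split=> //; lra.
Qed.

End OneParameter.

(** * Three agents *)

Section ThreeAgents.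
Variable R : realType.
Implicit Types (h : R -> R -> R -> R * R) (a b c d : R).

Record nice3 (G : R) h : Prop := Nice3 {
  G_ge0 : 0 <= G;
  tr_a : forall b c, truthful (fun t => h t b c);
  tr_b : forall a c, truthful (fun t => h a t c);
  tr_c : forall a b, truthful (fun t => h a b t);
  ap_ab : forall a b c p, p \in [:: a; b; c] -> cost (h a b c) p <= G * `|b - a|;
  ap_bc : forall a b c p, p \in [:: a; b; c] -> cost (h a b c) p <= G * `|c - b|;
  ap_ac : forall a b c p, p \in [:: a; b; c] -> cost (h a b c) p <= G * `|c - a| }.

Definition swap_ab h a b c := h b a c.
Definition refl3 h a b c := oppp (h (- c) (- b) (- a)).

Lemma nice3_swap G h : nice3 G h -> nice3 G (swap_ab h).
Proof.
case=> G0 ta tb tc ab bc ac; split=> [|b c|a c|a b|a b c p H|a b c p H|a b c p H].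
- by [].
- exact: tb.
- exact: ta.
- exact: tc.
- by rewrite distrC; apply: ab; move: H; rewrite !inE orbCA.
- by apply: ac; move: H; rewrite !inE orbCA.
- by apply: bc; move: H; rewrite !inE orbCA.
Qed.

Lemma nice3_refl G h : nice3 G h -> nice3 G (refl3 h).
Proof.
case=> G0 ta tb tc ab bc ac.
have mN a b c p : p \in [:: a; b; c] -> - p \in [:: - c; - b; - a].
  by rewrite !inE !eqr_opp => /or3P[] ->; rewrite ?orbT.
split=> [|b c|a c|a b|a b c p H|a b c p H|a b c p H].
- by [].
- exact: truthful_opp (tc _ _).
- exact: truthful_opp (tb _ _).
- exact: truthful_opp (ta _ _).
- by rewrite /refl3 cost_opp; apply: le_trans (bc _ _ _ _ (mN _ _ _ _ H)) _; rewrite opprK addrC.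
- by rewrite /refl3 cost_opp; apply: le_trans (ab _ _ _ _ (mN _ _ _ _ H)) _; rewrite opprK addrC.
- by rewrite /refl3 cost_opp; apply: le_trans (ac _ _ _ _ (mN _ _ _ _ H)) _; rewrite opprK addrC.
Qed.

Section Fixed.
Variables (G : R) (h : R -> R -> R -> R * R).
Hypothesis N : nice3 G h.

Let G0 : 0 <= G := G_ge0 N.

Lemma near3 a b c p d : p \in [:: a; b; c] ->
  [\/ `|b - a| <= d, `|c - b| <= d | `|c - a| <= d] ->
  exists2 l, on (h a b c) l & p - G * d <= l <= p + G * d.
Proof.
move=> Hp H; apply: cost_near; case: H => H.
- exact: le_trans (ap_ab N Hp) (ler_wpM2l G0 H).
- exact: le_trans (ap_bc N Hp) (ler_wpM2l G0 H).
- exact: le_trans (ap_ac N Hp) (ler_wpM2l G0 H).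
Qed.

Lemma on_abb a b : on (h a b b) b.
Proof.
have [||l H1] := @near3 a b b b 0; rewrite ?inE ?eqxx ?orbT //.
  by constructor 2; rewrite subrr normr0.
rewrite mulr0 => /andP[? ?]; have E : l = b by lra.
by rewrite E in H1.
Qed.

(** The factor [G + 2] puts the facility near [a] left of [b - (c - b)]. Imitating each other, [b]
    and [c] both get a facility within [c - b], necessarily the same other one, which therefore lies
    in [[b, c]]. *)
Lemma close_pair a b c : a < b -> b < c -> (G + 2) * (c - b) <= b - a ->
  exists l1 l2, [/\ on (h a b c) l1, on (h a b c) l2, 
    l1 <= a + G * (c - b), b <= l2 <= c &
    forall l, on (h a b c) l -> l = l1 \/ l = l2].
Proof.
move=> ab bc ws.
have [||l1 y1 /andP[h1 h2]] := @near3 a b c a (c - b); rewrite ?inE ?eqxx ?orbT //.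
  by constructor 2; rewrite ger0_norm //; lra.
have yb := on_abb a c.
have [|l2 y2 /andP[h3 h4]] := truthful_near (p := b) (d := c - b) (tr_b N a c) yb.
  by apply/andP; split; lra.
have yc := on_abb a b.
have [|l3 y3 /andP[h5 h6]] := truthful_near (p := c) (d := c - b) (tr_c N a b) yc.
  by apply/andP; split; lra.
have E : l2 = l3 by apply: (on3 y1 y2 y3); lra.
exists l1, l2; split=> //; first by apply/andP; split; lra.
move=> l yl; move: y1 y2 yl; rewrite /on.
move=> /orP[]/eqP E1 /orP[]/eqP E2 /orP[]/eqP E3; rewrite ?E3 -?E1 -?E2;
  first [by left | by right | exfalso; lra].
Qed.

(* In the cluster {b, c}, far to the right of a, the lower agent is served. *)
Definition lower_wins a b := a < b /\
  forall c, b < c -> (G + 2) * (c - b) <= b - a -> on (h a b c) b.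

(** Change the report [c] to [c']. If the new cluster facility is at most [c], it must be [b], or
    report [c] would do better by imitation. If it is beyond [c], the hole above [c] ends at a point
    serving some report [s] below it, outside [[b, s]]. *)
Lemma lower_wins_witness a b c : a < b -> b < c -> (G + 2) * (c - b) <= b - a ->
  on (h a b c) b -> lower_wins a b.
Proof.
move=> ab bc ws yb; split=> // c' bc' ws'.
have [l1 [l2 [y1 y2 h1 /andP[h2 h3] E]]] := close_pair ab bc ws.
have {E y2 h2 h3} E l : on (h a b c) l -> l = l1 \/ l = b.
  move=> yl; case: (E _ yb) => ?; subst; first by lra.
  exact: E.
have [l1' [l2' [y1' y2' h1' /andP[h2' h3'] E']]] := close_pair ab bc' ws'.
have Gc : 0 <= G * (c - b) by rewrite mulr_ge0 //; lra.
have Gc' : 0 <= G * (c' - b) by rewrite mulr_ge0 //; lra.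
have [l2c|cl2] := leP l2' c.
  have [|l yl /andP[h4 h5]] := truthful_near (p := c) (d := c - l2') (tr_c N a b) y2'.
    by apply/andP; split; lra.
  have l2b : l2' = b by case: (E _ yl) => ?; subst; lra.
  by rewrite -{2}l2b.
have nc : ~~ on (h a b c) c by apply/negP => /E[] ?; subst; lra.
have [|u [s [h4 h5 h6 _ h7]]] := hole_right (tr_c N a b) y2' cl2 nc (eps := 1).
  by [].
have bs : b < s by lra.
have Gs : G * (s - b) <= G * (c' - b) by rewrite ler_wpM2l //; lra.
have [|m1 [m2 [_ _ k1 /andP[k2 k3] E2]]] := close_pair ab bs; first by lra.
by case: (E2 _ h7) => ?; subst; lra.
Qed.

Lemma lower_wins_step a b b' : lower_wins a b -> b <= b' ->
  (G + 2) * 2 * (b' - b) <= b - a -> lower_wins a b'.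
Proof.
move=> P bb' ws; case: (eqVneq b b') => [<-//|nb].
have {bb'}bb' : b < b' by rewrite lt_neqAle nb.
(* Here [c - b] is twice [b' - b], so the factor 2 in the hypothesis makes [{s, c}] a cluster for
   every [s] from [b] to [b']. *)
case: (P) => ab Pb; set c := 2 * b' - b.
have b'c : b' < c by rewrite /c; lra.
have wc : (G + 2) * (c - b) <= b - a by rewrite /c; lra.
have Gc : 0 <= G * (b' - b) by rewrite mulr_ge0 //; lra.
apply: (@lower_wins_witness _ _ c) => //; [lra | rewrite /c; lra |].
have yb : on (h a b c) b by apply: Pb => //; lra.
apply/negP => /negP nb'.
have [|u [s [h4 h5 h6 _ h7]]] := hole_left (tr_b N a c) yb bb' nb' (eps := 1).
  by [].
have Gs : G * (c - s) <= G * (c - b) by rewrite ler_wpM2l //; lra.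
have [|||m1 [m2 [_ _ k1 /andP[k2 k3] E2]]] := @close_pair a s c; try lra.
by case: (E2 _ h7) => ?; subst; lra.
Qed.

Lemma lower_wins_up a b b' : lower_wins a b -> b <= b' -> lower_wins a b'.
Proof.
move=> P bb'; have [ab _] := P.
(* The admissible step only grows as [b] moves away from [a], so the initial one can be iterated. *)
pose e := (b - a) / ((G + 2) * 2).
have G2 : 0 < (G + 2) * 2 by have := G0; lra.
have e0 : 0 < e by rewrite divr_gt0 // subr_gt0.
have eE : (G + 2) * 2 * e = b - a by rewrite /e mulrC divfK ?gt_eqF.
suff H n : forall b', b <= b' -> b' <= b + n%:R * e -> lower_wins a b'.
  apply: (H (Num.bound ((b' - b) / e))) => //.
  have := archi_boundP (divr_ge0 (_ : 0 <= b' - b) (ltW e0)).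
  rewrite subr_ge0 => /(_ bb'); rewrite ltr_pdivrMr // => ?; lra.
elim: n => [|n IH] {bb'}b' bb'.
  by rewrite mul0r addr0 => b'b; have -> : b' = b by lra.
rewrite -natr1 mulrDl mul1r => b'n.
have [b'n'|b'n'] := leP b' (b + n%:R * e); first exact: IH.
have ne : 0 <= n%:R * e by rewrite mulr_ge0 // ltW.
apply: (@lower_wins_step _ (b + n%:R * e)); [|lra|].
  by apply: IH => //; lra.
suff : (G + 2) * 2 * (b' - (b + n%:R * e)) <= (G + 2) * 2 * e by lra.
by rewrite ler_pM2l //; lra.
Qed.

(** Otherwise the hole above [b] ends at a [v] serving a report [s] just below it. Moving [c] to [v]
    keeps [v] served, while [lower_wins] at [s] serves [s]: two facilities in the cluster
    [{s, v}]. *)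
Lemma lower_wins_all a b c : lower_wins a b -> b < c -> on (h a b c) b.
Proof.
move=> P bc; have [ab _] := P; apply/negP => /negP nb.
have yc := on_abb a c.
pose e := (b - a) / (G + 2).
have G2 : 0 < G + 2 by have := G0; lra.
have e0 : 0 < e by rewrite divr_gt0 // subr_gt0.
have eE : (G + 2) * e = b - a by rewrite /e mulrC divfK ?gt_eqF.
have [v [s [h1 h2 h3 h4 h5]]] := hole_right (tr_b N a c) yc bc nb e0.
have yv := truthful_on (tr_c N a s) h5.
have [_ Ps] := lower_wins_up P (ltW h3).
have ws : (G + 2) * (v - s) <= s - a.
  have : (G + 2) * (v - s) <= (G + 2) * e by rewrite ler_pM2l //; lra.
  by lra.
have ys := Ps _ h2 ws.
have as_ : a < s by lra.
have [m1 [m2 [_ _ k1 /andP[k2 k3] E2]]] := close_pair as_ h2 ws.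
have Gv : 0 <= G * (v - s) by rewrite mulr_ge0 //; lra.
by case: (E2 _ yv) => ?; case: (E2 _ ys) => ?; subst; lra.
Qed.

(** The hole below [c] starts at a [u] serving a report [s] just above it; moving [b] to [u] gives a
    cluster [{u, s}] with [u] served. *)
Lemma lower_wins_exists a b c : a < b -> b < c -> on (h a b c) b ->
  ~~ on (h a b c) c -> exists u, lower_wins a u.
Proof.
move=> ab bc yb nc.
pose e := (b - a) / (G + 2).
have G2 : 0 < G + 2 by have := G0; lra.
have e0 : 0 < e by rewrite divr_gt0 // subr_gt0.
have eE : (G + 2) * e = b - a by rewrite /e mulrC divfK ?gt_eqF.
have [u [s [h1 h2 h3 h4 h5]]] := hole_left (tr_c N a b) yb bc nc e0.
have yu := truthful_on (tr_b N a s) h5.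
exists u; apply: (lower_wins_witness _ h2 _ yu); first by lra.
have : (G + 2) * (s - u) <= (G + 2) * e by rewrite ler_pM2l //; lra.
by lra.
Qed.

End Fixed.
End ThreeAgents.

(** * Adjacent orders of three agents *)

Section Adjacent.
Variables (R : realType) (G : R).
Implicit Types (h : R -> R -> R -> R * R) (a b c : R).

Lemma on_refl3 h a b c l : on (refl3 h a b c) l = on (h (- c) (- b) (- a)) (- l).
Proof. exact: on_opp. Qed.

(** Defined by reflection, so that facts about [lower_wins] carry over to a cluster far to the left
    of [c]. *)
Definition upper_wins h c b := lower_wins G (refl3 h) (- c) (- b).

Lemma upper_winsP h c b : upper_wins h c b <-> b < c /\
  forall a, a < b -> (G + 2) * (b - a) <= c - b -> on (h a b c) b.
Proof.
split=> -[bc H]; split; rewrite ?ltrN2 // in bc *.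
  move=> a ab ws; have := H (- a); rewrite on_refl3 !opprK ltrN2 => -> //.
  by move: ws; rewrite addrC; congr (_ * _ <= _); lra.
move=> a; rewrite ltrNl => ab ws; rewrite on_refl3 !opprK; apply: H => //; lra.
Qed.

Lemma close_pair_up h a b c : nice3 G h -> a < b -> b < c ->
  (G + 2) * (b - a) <= c - b ->
  exists l1 l2, [/\ on (h a b c) l1, on (h a b c) l2, a <= l1 <= b,
    c - G * (b - a) <= l2 &
    forall l, on (h a b c) l -> l = l1 \/ l = l2].
Proof.
move=> /nice3_refl N ab bc ws.
have [|||l1 [l2 [y1 y2 h1 /andP[h2 h3] E]]] :=
  @close_pair _ _ _ N (- c) (- b) (- a); rewrite ?ltrN2 //; first by lra.
rewrite on_refl3 !opprK in y1; rewrite on_refl3 !opprK in y2.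
exists (- l2), (- l1); split=> //; [by apply/andP; split; lra | lra |].
move=> l yl; case: (E (- l)); first by rewrite on_refl3 !opprK.
  by move=> <-; rewrite opprK; right.
by move=> <-; rewrite opprK; left.
Qed.

Lemma upper_wins_down h c b b' : nice3 G h -> upper_wins h c b -> b' <= b ->
  upper_wins h c b'.
Proof.
by move=> /nice3_refl N H bb'; apply: (lower_wins_up N H); rewrite lerN2.
Qed.

Lemma upper_wins_all h a b c : nice3 G h -> upper_wins h c b -> a < b ->
  on (h a b c) b.
Proof.
move=> /nice3_refl N H ab; have := lower_wins_all N H (_ : - b < - a).
by rewrite on_refl3 !opprK ltrN2; apply.
Qed.

(** By [lower_wins_all], [b] is served for every [c] above it. Once [c] is far enough, [a] and [b]
    form the cluster and [b] is its upper agent. *)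
Lemma lower_wins_far h a b : nice3 G h -> lower_wins G h a b ->
  exists C, forall c, C <= c -> upper_wins h c b.
Proof.
move=> N P; have [ab _] := P.
have G0 : 0 <= G * (b - a) by rewrite mulr_ge0 ?(G_ge0 N) //; lra.
exists (b + (G + 2) * (b - a)) => c Cc.
have bc : b < c by lra.
have yb := lower_wins_all N P bc.
apply: (@lower_wins_witness _ _ _ (nice3_refl N) _ _ (- a)); rewrite ?ltrN2 //.
  by lra.
by rewrite on_refl3 !opprK.
Qed.

Definition middle_wins h := exists a b c, [/\ a < b, b < c & on (h a b c) b].

Lemma middle_wins_far h : nice3 G h -> middle_wins h ->
  exists b C, forall c, C <= c -> upper_wins h c b.
Proof.
move=> N [a [b [c [ab bc yb]]]].
have [yc|nc] := boolP (on (h a b c) c); last first.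
  have [u Pu] := lower_wins_exists N ab bc yb nc.
  by exists u; apply: lower_wins_far Pu.
(* Two facilities cannot serve three points, so the mirrored argument applies at [a]. *)
have na : ~~ on (h a b c) a by apply/negP => ya; have := on3 ya yb yc; lra.
have N' := nice3_refl N.
have [||||v Pv] := @lower_wins_exists _ _ _ N' (- c) (- b) (- a); rewrite ?ltrN2 //.
- by rewrite on_refl3 !opprK.
- by rewrite on_refl3 !opprK.
have : upper_wins h c (- v) by rewrite /upper_wins opprK.
move: (- v) => u {v Pv} Pu; have /upper_winsP[uc _] := Pu.
exists u.
pose a' := u - (G + 2) * (c - u).
have Gp : 0 <= G * (c - u) by rewrite mulr_ge0 ?(G_ge0 N) //; lra.
have a'u : a' < u by rewrite /a'; lra.
have yu := upper_wins_all N Pu a'u.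
apply: (@lower_wins_far _ a') => //.
by apply: (lower_wins_witness N a'u uc _ yu); rewrite /a'; lra.
Qed.

(* If both two-agent orders left of [c] let the upper agent win, then the lower
   end of the gap of the image of [a] below [b = m] lies just below a report of [a];
   moving [b] there serves two nearby points and abandons [c]. *)
Lemma upper_wins_conflict h c m : nice3 G h -> upper_wins h c m ->
  upper_wins (swap_ab h) c m -> False.
Proof.
move=> N U V; have [mc Um] := (upper_winsP _ _ _).1 U.
have G0 := G_ge0 N.
have G2 : 0 < G + 2 by lra.
pose e := (c - m) / (G + 2).
have e0 : 0 < e by rewrite divr_gt0 // subr_gt0.
have eE : (G + 2) * e = c - m by rewrite /e mulrC divfK ?gt_eqF.
pose a0 := m - e.
have a0m : a0 < m by rewrite /a0; lra.
have ws0 : (G + 2) * (m - a0) <= c - m by have -> : m - a0 = e; [rewrite /a0; lra | rewrite eE].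
have y0 := Um _ a0m ws0.
have na0 : ~~ on (h a0 m c) a0.
  apply/negP => ya.
  have [l1 [l2 [_ _ /andP[h1 h2] h3 E]]] := close_pair_up N a0m mc ws0.
  by case: (E _ y0) => ?; case: (E _ ya) => ?; lra.
(* A report so low that the facility the approximation bound puts near it lies below [a0]. *)
pose p := a0 - G * (c - m) - 1.
have [||w yw /andP[w1 w2]] := @near3 _ _ _ N p m c p (c - m); rewrite ?inE ?eqxx //.
  by constructor 2; rewrite ger0_norm //; lra.
have wa0 : w < a0 by move: w2; rewrite /p; lra.
have [u [s [h1 h2 h3 h4 h5]]] := hole_left (tr_a N m c) yw wa0 na0 e0.
have yu := truthful_on (tr_b N s c) h5.
have [|sc Vs] := (upper_winsP _ c s).1 (upper_wins_down (nice3_swap N) V _).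
  by lra.
have ws : (G + 2) * (s - u) <= c - s.
  have : (G + 2) * (s - u) <= (G + 2) * e by rewrite ler_pM2l //; lra.
  by lra.
have ys := Vs u h2 ws.
have [l1 [l2 [_ _ /andP[k1 k2] k3 E]]] := close_pair_up (nice3_swap N) h2 sc ws.
by case: (E _ yu) => ?; case: (E _ ys) => ?; lra.
Qed.

Lemma adjacent_orders h : nice3 G h -> middle_wins h ->
  middle_wins (swap_ab h) -> False.
Proof.
move=> N /(middle_wins_far N)[b1 [C1 H1]] /(middle_wins_far (nice3_swap N))[b2 [C2 H2]].
pose c := Num.max C1 C2; pose m := Num.min b1 b2.
have N' := nice3_swap N.
apply: (@upper_wins_conflict h c m N).
  by apply: (upper_wins_down N (H1 c _)); rewrite ?le_max ?ge_min ?lexx.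
by apply: (upper_wins_down N' (H2 c _)); rewrite ?le_max ?ge_min ?lexx ?orbT.
Qed.

End Adjacent.

(** * Four agents *)

Section FourAgents.
Variable R : realType.
Implicit Types (a b c d : R).

(* The rightmost one is always served, so [a] and
   [b] compete for the other facility; at the infimum of the [a] for which the
   report [y] of [b] is served the images of [a] and [b] are incompatible. *)
Lemma extend_block (h : R -> R -> R -> R -> R * R) (G a0 y c : R) :
    (forall b d c, truthful (fun t => h t b d c)) ->
    (forall a d c, truthful (fun t => h a t d c)) ->
    (forall a b c, truthful (fun t => h a b t c)) ->
    (forall a b d, truthful (fun t => h a b d t)) ->
    (forall a b d c, b < d -> d < c -> cost (h a b d c) a <= G * (c - b)) ->
    (forall a b d, a < b -> b < d -> on (h a b d d) d) ->
    (forall a d c, a < d -> d < c -> on (h a a d c) a) ->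
    (forall a b d c l, b < l -> l < c -> ~~ on (h a b d c) l) ->
    a0 < y -> y < c -> on (h a0 y y c) y -> False.
Proof.
move=> Ta Tb Td Tc ap top bot gap a0y yc yy.
have served_c a b d : a < b -> b < d -> d < c -> on (h a b d c) c.
  move=> ab bd dc; apply/negP => /negP nc.
  have [u [s [h1 h2 _ _ h3]]] := hole_left (Tc a b d) (top a b d ab bd) dc nc ltr01.
  by have /negP := gap a b d s u (lt_le_trans bd h1) h2.
(* A third keeps [2 * d - y] below [c]; the facility near [d] is then at least [y] and below [c],
   and [gap] leaves only [y]. *)
pose d := y + (c - y) / 3.
have yd : y < d by rewrite /d; lra.
have dc : d < c by rewrite /d; lra.
have on_y : on (h a0 y d c) y.
  have [|l yl /andP[l1 l2]] := truthful_near (p := d) (d := d - y) (Td a0 y c) yy.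
    by apply/andP; split; lra.
  have lc : l < c by move: l2; rewrite /d; lra.
  case: (ltgtP y l) => [yl'|ly|E]; [|lra|by rewrite -E in yl].
  by have /negP := gap a0 y d c l yl' lc.
have fill a b b0 : on (h a b0 d c) b0 -> a < b -> b < b0 -> b0 < d -> on (h a b d c) b.
  move=> y0 ab bb0 b0d; apply/negP => /negP nb.
  have [v [s [h1 h2 h3 _ h4]]] := hole_right (Tb a d c) y0 bb0 nb ltr01.
  by have /negP := gap a s d c v h2 (le_lt_trans h1 (lt_trans b0d dc)); apply.
pose I : set R := fun a => (a < y) && on (h a y d c) y.
have Ia0 : I a0 by rewrite /I a0y on_y.
have infI : has_inf I.
  split; first by exists a0.
  (* For lower [a], the approximation bound would need a third facility near [a], besides [y] and
     [c]. *)
  exists (y - G * (c - y)) => a /andP[ay ya].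
  have yc' := served_c a y d ay yd dc.
  have [l yl /andP[h1 h2]] := cost_near (ap a y d c yd dc).
  rewrite leNgt; apply/negP => K.
  have Gy : 0 <= G * (c - y) by apply: le_trans (cost_ge0 _ _) (ap a y d c yd dc).
  by have := on3 yl ya yc'; lra.
(* Tenths put [a2 = a1 - 2 * e] below the infimum, while [b1 = a1 + 3 * e] and even
   [2 * b1 - a2 = a1 + 8 * e] stay below [y]. *)
pose e := (y - a0) / 10.
have e0 : 0 < e by rewrite /e; lra.
have [a1 /andP[a1y ya1] inf1] := inf_adherent e0 infI.
have inf0 : inf I <= a0 by apply: ge_inf => //; case: infI.
pose a2 := a1 - 2 * e; pose b1 := a1 + 3 * e.
have b1y : b1 < y by rewrite /b1; move: inf1 inf0; rewrite /e; lra.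
(* Such an [l] is nearer to [a1] than [b] is, so report [a1] gets a facility below [b]; but there
   [b] and [c] are both served already. *)
have far a b l : a1 < b -> b < y -> on (h a b d c) l -> 2 * a1 - b < l -> l < b -> False.
  move=> a1b bby yl l1 l2.
  have yb := fill a1 b y ya1 a1b bby yd.
  have ycc := served_c a1 b d a1b (lt_trans bby yd) dc.
  pose r := Num.max (a1 - l) (l - a1).
  have [|l' yl' /andP[k1 k2]] := truthful_near (p := a1) (d := r) (Ta b d c) yl.
    have : a1 - l <= r /\ l - a1 <= r by rewrite /r !le_max !lexx orbT.
    by case=> ? ?; apply/andP; split; lra.
  have rb : r < b - a1 by rewrite /r gt_max; apply/andP; split; lra.
  by have := on3 yl' yb ycc; lra.
have a2b1 : a2 < b1 by rewrite /a2 /b1; lra.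
(* By [bot], the report [a2] of the second agent makes [a2] attained, so [b1] has a facility within
   [b1 - a2]; [gap] and [far] leave only [b1]. *)
have on_b1 : on (h a2 b1 d c) b1.
  have a2d : a2 < d by lra.
  have [|l yl /andP[l1 l2]] := truthful_near (p := b1) (d := b1 - a2) (Tb a2 d c) (bot a2 d c a2d dc).
    by apply/andP; split; lra.
  have lc : l < c by move: l2; rewrite /a2 /b1; move: inf1 inf0; rewrite /e; lra.
  case: (ltgtP b1 l) => [bl|lb|E]; last by rewrite -E in yl.
    by have /negP := gap a2 b1 d c l bl lc.
  by exfalso; apply: (far a2 b1 l) => //; move: l1; rewrite /a2 /b1; lra.
have n2 : ~~ on (h a2 y d c) y.
  apply/negP => y2.
  have : inf I <= a2 by apply: ge_inf; [case: infI | rewrite /I y2 andbT; lra].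
  by rewrite /a2; lra.
have [u [s [h1 h2 h3 _ h4]]] := hole_left (Tb a2 d c) on_b1 b1y n2 ltr01.
by apply: (far a2 s u) => //; rewrite /b1 in h1; lra.
Qed.

End FourAgents.

(** * Coalitions *)

Section Coalitions.
Variables (R : realType) (n : nat).
Implicit Types (f : mechanism R n) (x : profile R n) (A B D P Q S Y Z : {set 'I_n}).

Definition moved x S p : profile R n := fun i => if i \in S then p else x i.

(** The members of [S] move one at a time; each, once at [p], could report its old location. Hence a
    coalition can be treated as one agent. *)
Lemma moved_cost f x S p : strategy_proof f -> cost (f (moved x S p)) p <= cost (f x) p.
Proof.
move=> sp.
suff H (s : seq 'I_n) : cost (f (fun i => if i \in s then p else x i)) p <= cost (f x) p.
  have -> : moved x S p = fun i => if i \in enum S then p else x i.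
    by apply/funext => i; rewrite mem_enum.
  exact: H.
elim: s => [|j s IH]; first by rewrite le_eqVlt eqxx.
apply: le_trans IH; set y := fun i => if i \in s then p else x i.
have -> : (fun i => if i \in j :: s then p else x i) = upd y j p.
  by apply/funext => i; rewrite /upd /y inE; case: eqP.
have := sp j (upd y j p) (y j).
have -> : upd (upd y j p) j (y j) = y.
  by apply/funext => i; rewrite /upd; case: eqP => // ->.
by have -> : upd y j p j = p by rewrite /upd eqxx.
Qed.

Lemma moved_on f x S l : strategy_proof f -> on (f x) l -> on (f (moved x S l)) l.
Proof.
move=> sp yl; have := le_trans (moved_cost x S l sp) (cost_le l yl).
rewrite subrr normr0; have [l' yl' ->] := cost_fac (f (moved x S l)) l.
by rewrite normr_le0 subr_eq0 => /eqP E; rewrite E in yl'.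
Qed.

Lemma truthful_along f (X : R -> profile R n) S : strategy_proof f ->
  (forall t i, X t i = if i \in S then t else X 0 i) -> truthful (fun t => f (X t)).
Proof.
move=> sp H t s; have -> : X t = moved (X s) S t; last exact: moved_cost.
by apply/funext => i; rewrite /moved (H s) (H t); case: ifP.
Qed.

(** Bounding by the largest distance instead of the sum ignores how many agents share a location;
    the factor [n] goes into [G]. *)
Definition approx_within G f := 0 <= G /\ forall x l i d,
  (forall j, cost l (x j) <= d) -> cost (f x) (x i) <= G * d.

Lemma bounded_approx_within f : bounded_approx f -> exists G, approx_within G f.
Proof.
case=> g H; exists (Num.max g 0 * n%:R).
have m0 : 0 <= Num.max g 0 by rewrite le_max lexx orbT.
split=> [|x l i d Hd]; first by rewrite mulr_ge0.
have : cost (f x) (x i) <= SC f x.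
  rewrite /SC (bigD1 i) //= lerDl; apply: sumr_ge0 => j _; exact: cost_ge0.
move/le_trans; apply; apply: le_trans (H x l) _.
have S0 : 0 <= SC_loc l x by apply: sumr_ge0 => j _; exact: cost_ge0.
have Sn : SC_loc l x <= n%:R * d.
  have := @ler_sum _ _ (index_enum 'I_n) xpredT _ _ (fun j _ => Hd j).
  by rewrite sumr_const card_ord mulr_natl.
rewrite -mulrA; apply: le_trans (_ : Num.max g 0 * SC_loc l x <= _).
  by rewrite ler_wpM2r // le_max lexx.
by rewrite ler_wpM2l.
Qed.

(* Moving all other agents to [l] keeps the facility [l], so this says that in some
   three-location instance with [P] left and [Q] right the middle coalition is served. *)
Definition unblocked f P Q := exists x p q l, [/\ forall i, i \in P -> x i = p,
  forall i, i \in Q -> x i = q, p < l, l < q & on (f x) l].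

Definition reflm f : mechanism R n := fun x => oppp (f (fun i => - x i)).

Lemma strategy_proof_refl f : strategy_proof f -> strategy_proof (reflm f).
Proof.
move=> sp i x t; rewrite /reflm !cost_opp.
have := sp i (fun j => - x j) (- t); congr (_ <= cost (f _) _).
by apply/funext => j; rewrite /upd; case: eqP.
Qed.

Lemma approx_within_refl G f : approx_within G f -> approx_within G (reflm f).
Proof.
case=> G0 H; split=> // x l i d Hd; rewrite /reflm cost_opp.
apply: (H _ (oppp l)) => j; rewrite cost_opp opprK; exact: Hd.
Qed.

Lemma unblocked_refl f P Q : unblocked (reflm f) Q P <-> unblocked f P Q.
Proof.
split=> -[x [p [q [l [xp xq pl lq yl]]]]]; exists (fun i => - x i), (- q), (- p), (- l).
  split; rewrite ?ltrN2 //; last by rewrite -on_opp.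
    by move=> i /xq ->.
  by move=> i /xp ->.
split; rewrite ?ltrN2 //.
- by move=> i /xq ->.
- by move=> i /xp ->.
rewrite /reflm on_opp opprK; congr (on (f _) l) : yl.
by apply/funext => i; rewrite opprK.
Qed.

Lemma unblockedS f P P' Q Q' : P' \subset P -> Q' \subset Q ->
  unblocked f P Q -> unblocked f P' Q'.
Proof.
move=> /subsetP sP /subsetP sQ [x [p [q [l [xp xq pl lq yl]]]]].
by exists x, p, q, l; split=> // i iS; [apply/xp/sP | apply/xq/sQ].
Qed.

Definition pos3 P Q a b c : profile R n := fun i =>
  if i \in P then a else if i \in Q then c else b.

Definition pos4 A B D a b d c : profile R n := fun i =>
  if i \in A then a else if i \in B then b else if i \in D then d else c.

Definition part3 P Y Q := [/\ P != set0, Y != set0, Q != set0 &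
  forall i, ((i \in P) + (i \in Y) + (i \in Q) = 1)%N].

Definition part4 A B D Z := [/\ A != set0, B != set0, D != set0, Z != set0 &
  forall i, ((i \in A) + (i \in B) + (i \in D) + (i \in Z) = 1)%N].

Section Nice.
Variables (G : R) (f : mechanism R n).
Hypotheses (sp : strategy_proof f) (ap : approx_within G f).

Lemma nice3_coalitions P Y Q : part3 P Y Q ->
  nice3 G (fun a b c => f (pos3 P Q a b c)).
Proof.
case=> /set0Pn[iP HP] /set0Pn[iY HY] /set0Pn[iQ HQ] H.
have EP a b c : pos3 P Q a b c iP = a by rewrite /pos3 HP.
have EQ a b c : pos3 P Q a b c iQ = c.
  by rewrite /pos3 HQ; have := H iQ; rewrite HQ; case: (iQ \in P); case: (iQ \in Y).
have EY a b c : pos3 P Q a b c iY = b.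
  by rewrite /pos3; have := H iY; rewrite HY; case: (iY \in P) => //; case: (iY \in Q).
have costs l a b c d p : cost l a <= d -> cost l b <= d -> cost l c <= d ->
    p \in [:: a; b; c] -> cost (f (pos3 P Q a b c)) p <= G * d.
  move=> ha hb hc Hp.
  have [i <-] : exists i, pos3 P Q a b c i = p.
    by move: Hp; rewrite !inE => /or3P[]/eqP->; [exists iP|exists iY|exists iQ].
  by apply: (ap.2 _ l) => j; rewrite /pos3; case: ifP => // _; case: ifP.
have on0 (l1 l2 l : R) : l = l1 \/ l = l2 -> forall d, 0 <= d -> cost (l1, l2) l <= d.
  by move=> E d d0; apply: (near_cost (l := l)); [rewrite /on /=; case: E => ->; rewrite eqxx ?orbT | apply/andP; split; lra].
split=> [|b c|a c|a b|a b c p|a b c p|a b c p]; first exact: ap.1.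
- apply: (truthful_along (X := fun t => pos3 P Q t b c) (S := P)) => // t i.
  by rewrite /pos3; case: ifP.
- apply: (truthful_along (X := fun t => pos3 P Q a t c) (S := Y)) => // t i.
  by rewrite /pos3; have := H i; case: (i \in P); case: (i \in Q); case: (i \in Y).
- apply: (truthful_along (X := fun t => pos3 P Q a b t) (S := Q)) => // t i.
  by rewrite /pos3; have := H i; case: (i \in P); case: (i \in Q); case: (i \in Y).
(* In each bound the comparison pair omits one of the two locations whose distance is measured. *)
- apply: (costs (a, c)); [by apply: on0; [left|] | | by apply: on0; [right|]].
  by apply: le_trans (cost_le _ (_ : on _ a)) _; [rewrite /on eqxx | rewrite distrC].
- apply: (costs (a, c)); [by apply: on0; [left|] | | by apply: on0; [right|]].
  by apply: (cost_le _ (_ : on _ c)); rewrite /on eqxx orbT.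
- apply: (costs (a, b)); [by apply: on0; [left|] | by apply: on0; [right|] |].
  by apply: le_trans (cost_le _ (_ : on _ a)) _; [rewrite /on eqxx | rewrite distrC].
Qed.

Lemma unblocked_middle P Q : unblocked f P Q ->
  exists a b c, [/\ a < b, b < c & on (f (pos3 P Q a b c)) b].
Proof.
case=> x [p [q [l [xp xq pl lq yl]]]]; exists p, l, q; split=> //.
have := moved_on (~: (P :|: Q)) sp yl; congr (on (f _) l).
apply/funext => i; rewrite /moved /pos3 !inE negb_or.
by case: (boolP (i \in P)) => [/xp|_] //=; case: (boolP (i \in Q)) => [/xq|].
Qed.

Lemma unblocked_adjacent P Y Q : part3 P Y Q -> unblocked f P Q ->
  unblocked f Y Q -> False.
Proof.
move=> H /unblocked_middle M1 /unblocked_middle[a [b [c [ab bc yb]]]].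
apply: (adjacent_orders (nice3_coalitions H) M1).
exists a, b, c; split=> //; move: yb; congr (on (f _) b).
apply/funext => i; rewrite /pos3; case: H => _ _ _ /(_ i).
by case: (i \in P); case: (i \in Q); case: (i \in Y).
Qed.

(** For [c = b] the point [b] is served. If [c] were not, the hole below it would start at a
    [u >= b] serving a report [s > u] of [Q], so [u] would be strictly between [P] and [Q]. *)
Lemma blocked_right P Y Q a b c : part3 P Y Q -> ~ unblocked f P Q ->
  a < b -> b < c -> on (f (pos3 P Q a b c)) c.
Proof.
move=> H nM ab bc; have N := nice3_coalitions H; apply/negP => /negP nc.
have [u [s [h1 h2 _ _ yu]]] := hole_left (tr_c N a b) (on_abb N a b) bc nc ltr01.
apply: nM; exists (pos3 P Q a b s), a, s, u; split=> //; last exact: lt_le_trans h1.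
  by move=> i; rewrite /pos3 => ->.
move=> i iQ; rewrite /pos3 iQ; case: H => _ _ _ /(_ i); rewrite iQ.
by case: (i \in P); case: (i \in Y).
Qed.

End Nice.

Lemma part3_rev P Y Q : part3 P Y Q -> part3 Q Y P.
Proof. by case=> *; split=> // i; rewrite addnC addnA addnAC. Qed.

Lemma pos3_rev P Y Q a b c : part3 P Y Q ->
  (fun i => - pos3 Q P a b c i) = pos3 P Q (- c) (- b) (- a).
Proof.
case=> _ _ _ H; apply/funext => i; rewrite /pos3; have := H i.
by case: (i \in P); case: (i \in Q); case: (i \in Y).
Qed.

Lemma blocked_left G f P Y Q a b c : strategy_proof f -> approx_within G f ->
  part3 P Y Q -> ~ unblocked f P Q ->
  a < b -> b < c -> on (f (pos3 P Q a b c)) a.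
Proof.
move=> sp ap H nM ab bc.
have nM' : ~ unblocked (reflm f) Q P by move/unblocked_refl.
have := blocked_right (strategy_proof_refl sp) (approx_within_refl ap) (part3_rev H) nM'
  (_ : - c < - b) (_ : - b < - a).
by rewrite !ltrN2 /reflm on_opp (pos3_rev _ _ _ H) !opprK; apply.
Qed.

Lemma unblocked_adjacent_right G f P Y Q : strategy_proof f -> approx_within G f ->
  part3 P Y Q -> unblocked f P Q -> unblocked f P Y -> False.
Proof.
move=> sp ap H /unblocked_refl M1 /unblocked_refl M2.
exact: (unblocked_adjacent (strategy_proof_refl sp) (approx_within_refl ap) (part3_rev H) M1 M2).
Qed.

Lemma unblocked_extend G f A B D Z : strategy_proof f -> approx_within G f ->
  part4 A B D Z -> unblocked f A Z ->
  [\/ unblocked f (A :|: B) Z, unblocked f A (D :|: Z) | unblocked f B Z].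
Proof.
move=> sp ap H M.
have [|nAB] := EM (unblocked f (A :|: B) Z); first by constructor 1.
have [|nDZ] := EM (unblocked f A (D :|: Z)); first by constructor 2.
have [|nBZ] := EM (unblocked f B Z); first by constructor 3.
exfalso; have [nA nB nD nZ Hi] := H.
have [a0 [y [c [a0y yc yy]]]] := unblocked_middle sp M.
have pU (X Y : {set 'I_n}) : X != set0 -> X :|: Y != set0.
  by case/set0Pn => i iX; apply/set0Pn; exists i; rewrite inE iX.
have P3 : part3 A B (D :|: Z).
  by split=> [||| i] //; [exact: pU | rewrite inE; have := Hi i; do 4 case: (i \in _)].
have P3' : part3 (A :|: B) D Z.
  by split=> [||| i] //; [exact: pU | rewrite inE; have := Hi i; do 4 case: (i \in _)].
apply: (@extend_block _ (fun a b d c => f (pos4 A B D a b d c)) G a0 y c) => //.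
- move=> b d e; apply: (truthful_along (X := fun t => pos4 A B D t b d e) (S := A)) => // t i.
  by rewrite /pos4; case: ifP.
- move=> a d e; apply: (truthful_along (X := fun t => pos4 A B D a t d e) (S := B)) => // t i.
  by rewrite /pos4; have := Hi i; do 4 case: (i \in _).
- move=> a b e; apply: (truthful_along (X := fun t => pos4 A B D a b t e) (S := D)) => // t i.
  by rewrite /pos4; have := Hi i; do 4 case: (i \in _).
- move=> a b d; apply: (truthful_along (X := fun t => pos4 A B D a b d t) (S := Z)) => // t i.
  by rewrite /pos4; have := Hi i; do 4 case: (i \in _).
- move=> a b d e bd dc; have /set0Pn[i iA] := nA.
  have E : pos4 A B D a b d e i = a by rewrite /pos4 iA.
  rewrite -{2}E; apply: (ap.2 _ (a, b)) => j; rewrite /pos4.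
  have on1 : on (a, b) a by rewrite /on eqxx.
  have on2 : on (a, b) b by rewrite /on eqxx orbT.
  case: ifP => _; first by apply: (near_cost on1); apply/andP; split; lra.
  by case: ifP => _; [|case: ifP => _]; apply: (near_cost on2); apply/andP; split; lra.
- move=> a b d ab bd; have := blocked_right sp ap P3 nDZ ab bd; congr (on (f _) d).
  by apply/funext => i; rewrite /pos3 /pos4 inE; have := Hi i; do 4 case: (i \in _).
- move=> a d e ad dc; have := blocked_left sp ap P3' nAB ad dc; congr (on (f _) a).
  by apply/funext => i; rewrite /pos3 /pos4 inE; have := Hi i; do 4 case: (i \in _).
- move=> a b d e l bl lc; apply/negP => yl; apply: nBZ.
  exists (pos4 A B D a b d e), b, e, l; split=> // i; rewrite /pos4;
    by have := Hi i; do 4 case: (i \in _).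
- move: yy; congr (on (f _) y).
  by apply/funext => i; rewrite /pos3 /pos4; have := Hi i; do 4 case: (i \in _).
Qed.

Lemma unblocked_extend_right G f A B D Z : strategy_proof f -> approx_within G f ->
  part4 A B D Z -> unblocked f A Z ->
  [\/ unblocked f (A :|: B) Z, unblocked f A (D :|: Z) | unblocked f A D].
Proof.
move=> sp ap [nA nB nD nZ H] /unblocked_refl M.
have H' : part4 Z D B A by split=> // i; rewrite -(H i); do 4 case: (i \in _).
case: (unblocked_extend (strategy_proof_refl sp) (approx_within_refl ap) H' M).
- by rewrite setUC => /unblocked_refl; constructor 2.
- by rewrite setUC => /unblocked_refl; constructor 1.
- by move/unblocked_refl; constructor 3.
Qed.

End Coalitions.

(** * Locating the powerful agent *)

Section Dictator.
Variables (n : nat) (M : {set 'I_n} -> {set 'I_n} -> Prop).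
Implicit Types (A B D P Q S Y Z q r : {set 'I_n}).

(** [M] stands for [unblocked f], of which only these five properties enter the combinatorics. *)
Hypothesis mono : forall P P' Q Q', P' \subset P -> Q' \subset Q -> M P Q -> M P' Q'.
Hypothesis adjl : forall P Y Q, part3 P Y Q -> M P Q -> M Y Q -> False.
Hypothesis adjr : forall P Y Q, part3 P Y Q -> M P Q -> M P Y -> False.
Hypothesis extl : forall A B D Z, part4 A B D Z -> M A Z ->
  [\/ M (A :|: B) Z, M A (D :|: Z) | M B Z].
Hypothesis extr : forall A B D Z, part4 A B D Z -> M A Z ->
  [\/ M (A :|: B) Z, M A (D :|: Z) | M A D].

(* The middle coalition [B :|: D] loses its power when either part joins an end. *)
Definition tied A Z B D := [/\ M A Z, ~ M (A :|: B) Z, ~ M (A :|: D) Z,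
  ~ M A (B :|: Z) & ~ M A (D :|: Z)].

Definition part5 A B Z q r := [/\ A != set0, B != set0, Z != set0 &
  [/\ q != set0, r != set0 & forall i,
  ((i \in A) + (i \in B) + (i \in Z) + (i \in q) + (i \in r) = 1)%N]].

Lemma part4_swap A B D Z : part4 A B D Z -> part4 A D B Z.
Proof. by case=> nA nB nD nZ H; split=> // i; rewrite -(H i); do 4 case: (i \in _). Qed.

Lemma part4_rot1 A B D Z : part4 A B D Z -> part4 B A D Z.
Proof. by case=> nA nB nD nZ H; split=> // i; rewrite -(H i); do 4 case: (i \in _). Qed.

Lemma part4_rot2 A B D Z : part4 A B D Z -> part4 A Z D B.
Proof. by case=> nA nB nD nZ H; split=> // i; rewrite -(H i); do 4 case: (i \in _). Qed.

Lemma part4_left A B D Z : part4 A B D Z -> part3 (A :|: B) D Z.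
Proof.
case=> nA nB nD nZ H; split=> // [|i]; first by rewrite setU_eq0 negb_and nA.
by rewrite inE; move: (H i); do 4 case: (i \in _).
Qed.

Lemma part4_right A B D Z : part4 A B D Z -> part3 A B (D :|: Z).
Proof.
case=> nA nB nD nZ H; split=> // [|i]; first by rewrite setU_eq0 negb_and nD.
by rewrite inE; move: (H i); do 4 case: (i \in _).
Qed.

(** Given [M (A :|: B) Z], extend by [D] instead: every outcome except [M A (B :|: Z)] yields
    [M D Z], which is adjacent. The same holds with [B] and [D] exchanged. If neither part can join
    [A], the mirrored extension shows that neither can join [Z]. *)
Lemma trichotomy A B D Z : part4 A B D Z -> M A Z ->
  [\/ M (A :|: B) Z /\ M A (B :|: Z), M (A :|: D) Z /\ M A (D :|: Z) | tied A Z B D].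
Proof.
move=> H MAZ; have H' := part4_swap H.
have e1 := extl H MAZ; have e2 := extr H MAZ.
have e3 := extl H' MAZ; have e4 := extr H' MAZ.
have n1 := adjl (part4_left H); have n2 := adjl (part4_left H').
have n3 := adjr (part4_right H); have n4 := adjr (part4_right H').
have m1 : M (A :|: B) Z -> M B Z by apply: mono; rewrite ?subsetUr.
have m2 : M (A :|: D) Z -> M D Z by apply: mono; rewrite ?subsetUr.
have m3 : M A (B :|: Z) -> M A B by apply: mono; rewrite ?subsetUl.
have m4 : M A (D :|: Z) -> M A D by apply: mono; rewrite ?subsetUl.
have [a1|a1] := EM (M (A :|: B) Z).
  by constructor 1; case: e3 => // x; case: (n1 a1); auto.
have [a2|a2] := EM (M (A :|: D) Z).
  by constructor 2; case: e1 => // x; case: (n2 a2); auto.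
have w1 : ~ M A (B :|: Z) by move=> w; case: e2 => // x; case: (n4 w); auto.
have w2 : ~ M A (D :|: Z) by move=> w; case: e4 => // x; case: (n3 w); auto.
by constructor 3.
Qed.

Lemma tied_swap A Z B D : tied A Z B D -> tied A Z D B.
Proof. by case. Qed.

Lemma tied_middle A Z B D : part4 A B D Z -> tied A Z B D -> M B Z /\ M A B.
Proof.
move=> H [MAZ a1 a2 w1 w2]; split; first by case: (extl H MAZ).
by case: (extr (part4_swap H) MAZ).
Qed.

(** A non-tie would give [M (B :|: A) Z], denied by the tie, or [M (B :|: D) Z], adjacent to
    [M A Z]. *)
Lemma tied_rot1 A Z B D : part4 A B D Z -> tied A Z B D -> tied B Z A D.
Proof.
move=> H T; have [MBZ _] := tied_middle H T; case: T => MAZ a1 _ _ _.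
case: (trichotomy (part4_rot1 H) MBZ) => // -[]; first by rewrite setUC.
by move=> x _; case: (adjl (part4_left (part4_swap (part4_rot1 H))) x MAZ).
Qed.

Lemma tied_rot2 A Z B D : part4 A B D Z -> tied A Z B D -> tied A B Z D.
Proof.
move=> H T; have [_ MAB] := tied_middle H T; case: T => MAZ _ _ w1 _.
case: (trichotomy (part4_rot2 H) MAB) => // -[_]; first by rewrite setUC.
by move=> x; case: (adjr (part4_right (part4_rot2 H)) x MAZ).
Qed.

Ltac parts := split=> [|||| ?]; rewrite ?setU_eq0 ?negb_and ?inE;
  repeat (match goal with K : is_true (_ != set0) |- _ => rewrite ?K; clear K end);
  rewrite ?orbT //;
  match goal with K : forall j, _ = 1%N |- context [?x \in _] => move: (K x) end;
  do 5 case: (_ \in _).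


Lemma tied_rev A Z B D : part4 A B D Z -> tied A Z B D -> tied Z A B D.
Proof.
move=> H T; have H2 := part4_rot2 H; have T2 := tied_rot2 H T.
have H3 := part4_rot1 H2; have T3 := tied_rot1 H2 T2.
exact: tied_rot2 H3 T3.
Qed.

(* A tie is symmetric in its four coalitions; here [q] would be a dummy agent next
   to the tie of [A, B, Z, r], which is refuted by letting [q] be an end. *)
Lemma tied_absorb A B Z q r : part5 A B Z q r -> tied A Z B (q :|: r) ->
  M (A :|: q) B -> False.
Proof.
case=> nA nB nZ [nq nr H] T MAqB.
have H1 : part4 A B (q :|: r) Z by parts.
have H2 : part4 A Z (q :|: r) B by parts.
have TAB := tied_rot2 H1 T; have [TAB0 _ _ _ _] := TAB.
have [MZB ZAB _ _ _] := tied_rot1 H2 TAB.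
have [MBA BZA _ _ _] : tied B A Z (q :|: r) by apply: tied_rev TAB.
have [MqrZ _] := tied_middle (part4_swap H1) (tied_swap T).
have H3 : part4 Z r (A :|: q) B by parts.
have nZr : ~ M (Z :|: r) B.
  by apply: (adjl _ MAqB); apply: part4_left; parts.
have T1 : tied Z B r (A :|: q).
  case: (trichotomy H3 MZB) => // -[]; first by move/nZr.
  by move=> x _; case: ZAB; apply: mono x; rewrite // setUS ?subsetUl.
have [_ MBAq] : M (A :|: q) Z /\ M B (A :|: q).
  by apply: (@tied_middle B Z (A :|: q) r); [parts | exact: tied_swap (tied_rev H3 T1)].
have H4 : part4 B q (Z :|: r) A by parts.
have MBqA : M (B :|: q) A.
  case: (trichotomy H4 MBA) => [[]//|[x _]|[_ _ _]].
    by case: BZA; apply: mono x; rewrite // setUS ?subsetUl.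
  by rewrite setUC => /(_ MBAq).
(* Now [q] becomes the left end, once against [B :|: A] and once against [r :|: Z]; these right ends
   partition the rest, so the two orders are adjacent. *)
have H5 : part4 q B (Z :|: r) A by parts.
have MqBA : M q (B :|: A).
  have MqA : M q A by apply: mono MBqA; rewrite ?subsetUr.
  case: (trichotomy H5 MqA) => [[]//|[x _]|[_]]; last by rewrite setUC => /(_ MBqA).
  by case: (adjl (part4_left (part4_swap H5)) x MBA).
have H6 : part4 q r (A :|: B) Z by parts.
have MqrZ' : M q (r :|: Z).
  have MqZ : M q Z by apply: mono MqrZ; rewrite ?subsetUl.
  have MrZ : M r Z by apply: mono MqrZ; rewrite ?subsetUr.
  case: (trichotomy H6 MqZ) => [[]//|[x _]|[_ /(_ MqrZ)//]].
  by case: (adjl (part4_left (part4_swap H6)) x MrZ).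
rewrite setUC in MqBA.
by apply: (adjr _ MqrZ' MqBA); apply: part4_right; parts.
Qed.

(** Split the middle of [(A, B)] into [q] and [Z :|: r]. If [q] joins [A], [tied_absorb] applies;
    [Z] cannot join [A]; and a tie gives [M (Z :|: r) B], where [tied_absorb] applies to the
    reversed tie with [r]. *)
Lemma tied_part_indivisible A B Z q r : part5 A B Z q r ->
  ~ tied A Z B (q :|: r).
Proof.
move=> H5 T; have := H5; case=> nA nB nZ [nq nr H].
have H1 : part4 A B (q :|: r) Z by parts.
have T2 := tied_rot2 H1 T; have [MAB nAZB _ _ _] := T2.
have H2 : part4 A q (Z :|: r) B by parts.
case: (trichotomy H2 MAB) => [[x _]|[x _]|T3].
- exact: tied_absorb H5 T x.
- by apply: nAZB; apply: mono x; rewrite // setUS ?subsetUl.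
have [MZrB _] := tied_middle (part4_swap H2) (tied_swap T3).
apply: (@tied_absorb Z B A r q) MZrB.
  by split=> //; split=> // i; rewrite -(H i); do 5 case: (i \in _).
by rewrite setUC; apply: tied_rev T.
Qed.

Lemma tied_small A B D Z : part4 A B D Z -> tied A Z B D -> (#|D| <= 1)%N.
Proof.
move=> [nA nB nD nZ H] T; rewrite leqNgt; apply/negP => D1.
have [d dD] := set0Pn _ nD.
apply: (@tied_part_indivisible A B Z [set d] (D :\ d)); last by rewrite setD1K.
split=> //; split.
- by apply/set0Pn; exists d; rewrite inE.
- by rewrite -card_gt0; move: D1; rewrite (cardsD1 d D) dD.
move=> i; rewrite -(H i) !inE; case: (eqVneq i d) => [->|_] /=.
  by rewrite dD; do 3 case: (d \in _).
by do 4 case: (i \in _).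
Qed.

Lemma card_part4 A B D Z : part4 A B D Z -> (#|A| + #|B| + #|D| + #|Z|)%N = n.
Proof.
case=> _ _ _ _ H.
have cE (X : {set 'I_n}) : #|X| = (\sum_i (i \in X))%N.
  by rewrite -sum1_card [LHS]big_mkcond; apply: eq_bigr => i _; case: (i \in X).
rewrite !cE -!big_split /= (eq_bigr (fun=> 1%N)) => [|i _]; last exact: H.
by rewrite sum_nat_const card_ord muln1.
Qed.

Hypothesis n5 : (5 <= n)%N.

(* This is where five agents are needed: a tie has only singletons. *)
Lemma not_tied A B D Z : part4 A B D Z -> ~ tied A Z B D.
Proof.
move=> H T; have := card_part4 H.
have cD := tied_small H T.
have cB := tied_small (part4_swap H) (tied_swap T).
have T1 := tied_swap (tied_rot1 H T).
have cA := tied_small (part4_swap (part4_rot1 H)) T1.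
have T2 := tied_swap (tied_rot2 H T).
have cZ := tied_small (part4_swap (part4_rot2 H)) T2.
by move: n5 => /[swap] <-; lia.
Qed.

(** Split one agent [d] off the middle [S]. Without ties, either [d] joins the left end and [S]
    shrinks, or all the rest joins and [d] is the agent sought. *)
Lemma left_dictator k S : (exists i, i \notin k |: S) -> S != set0 -> k \notin S ->
  M (~: (k |: S)) [set k] -> exists2 j, j \in S & M (~: [set j; k]) [set k].
Proof.
move=> ex; have [m] := ubnP #|S|; elim: m => // m IH in S ex *.
rewrite ltnS => Sm nS kS MS; have [d dS] := set0Pn _ nS.
case: (eqVneq (S :\ d) set0) => [S0|nS2].
  by exists d => //; move: MS; rewrite -(setD1K dS) S0 setU0 setUC.
have [i ik] := ex.
have H : part4 (~: (k |: S)) [set d] (S :\ d) [set k].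
  split=> //; try by apply/set0Pn; eexists; rewrite inE.
    by apply/set0Pn; exists i; rewrite inE.
  move=> j; rewrite !inE; case: (eqVneq j k) => [->|jk]; rewrite ?(negPf kS) ?orbT /= ?andbF.
    by case: eqP dS kS => // <- ->.
  by case: (eqVneq j d) => [->|_]; rewrite ?dS //=; case: (j \in S).
have kd : k != d by apply: contraNneq kS => ->.
case: (trichotomy H MS) => [[x _]|[x _]|/(not_tied H)//].
  have E : ~: (k |: S) :|: [set d] = ~: (k |: S :\ d).
    apply/setP => j; rewrite !inE; case: (eqVneq j d) => [->|_] /=; rewrite ?orbF ?orbT //.
    by rewrite eq_sym (negPf kd).
  rewrite E in x.
  have [|||j jS Mj] := IH (S :\ d) _ _ nS2 _ x.
  - by exists i; apply: contra ik; rewrite !inE => /orP[->//|/andP[_ ->]]; rewrite orbT.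
  - by move: Sm; rewrite (cardsD1 d S) dS.
  - by rewrite !inE (negPf kS) andbF.
  by exists j => //; move: jS; rewrite !inE => /andP[].
exists d => //; congr (M _ _) : x; apply/setP => j; rewrite !inE.
case: (eqVneq j d) => [->|jd] /=; first by rewrite dS orbT.
by case: (eqVneq j k) => [->|_] /=; [rewrite (negPf kS) | case: (j \in S)].
Qed.

(** The agent [j] found on the left also works on the right: in the trichotomy for [(i, k)], letting
    [j] join [i] would make [({j}, {k})] adjacent to the order already found. *)
Lemma dictator i k : i != k -> M [set i] [set k] ->
  exists j, [/\ j != i, j != k, M (~: [set j; k]) [set k] & M [set i] (~: [set i; j])].
Proof.
move=> ik Mik.
pose S := ~: [set k; i].
have E : ~: (k |: S) = [set i].
  apply/setP => j; rewrite !inE negb_or negbK.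
  by case: (eqVneq j k) => [->|_] /=; rewrite ?(eq_sym k) ?(negPf ik).
have cS : (#|S| + 2 = n)%N.
  by have := cardsC [set k; i]; rewrite cards2 eq_sym ik card_ord /S addnC.
have [||||j jS Mj] := @left_dictator k S.
- by exists i; rewrite -in_setC E inE.
- by rewrite -card_gt0; lia.
- by rewrite !inE eqxx.
- by rewrite E.
have := jS; rewrite !inE negb_or => /andP[jk ji].
exists j; split=> //.
have H : part4 [set i] (S :\ j) [set j] [set k].
  split; try by apply/set0Pn; eexists; rewrite inE.
    have := cardsD1 j S; rewrite jS => e.
    by rewrite -card_gt0; lia.
  move=> t; rewrite !inE; case: (eqVneq t i) => [->|ti] /=.
    by rewrite orbT andbF eq_sym (negPf ji) (negPf ik).
  case: (eqVneq t j) => [->|tj] /=; first by rewrite (negPf jk).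
  by case: (t == k).
case: (trichotomy H Mik) => [[_ x]|[x _]|/(not_tied H)//].
  congr (M _ _) : x; apply/setP => t; rewrite !inE.
  case: (eqVneq t k) => [->|tk] /=; last by rewrite orbF negb_or andbC.
  by rewrite orbT eq_sym (negPf ik) eq_sym (negPf jk).
exfalso; apply: (@adjl (~: [set j; k]) [set j] [set k]) Mj _.
  split; try by apply/set0Pn; eexists; rewrite inE.
    by apply/set0Pn; exists i; rewrite !inE negb_or eq_sym ji ik.
  move=> t; rewrite !inE; case: (eqVneq t j) => [->|_] /=; first by rewrite (negPf jk).
  by case: (t == k).
by apply: mono x; rewrite ?subsetUr.
Qed.

End Dictator.

(** * Two distinct facilities strictly inside the profile *)

Unset Implicit Arguments.

Theorem theorem1 (R : realType) (n : nat) (hn : (5 <= n)%N)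
    (f : mechanism R n) (hf : nice f) (x : profile R n) :
  (exists l : R, (l = (f x).1 \/ l = (f x).2) /\ (loc_ge_max x l \/ loc_le_min x l))
  \/ (f x).1 = (f x).2.
Proof.
have [sp /bounded_approx_within[G ap]] := hf.
have [?|ne] := EM ((f x).1 = (f x).2); [by right | left].
apply: contrapT => bad.
have above l : on (f x) l -> exists k, l < x k.
  move=> yl; apply: contrapT => nk; apply: bad; exists l.
  split; first by case/orP: yl => /eqP; auto.
  by left=> k; rewrite leNgt; apply/negP => lk; apply: nk; exists k.
have below l : on (f x) l -> exists i, x i < l.
  move=> yl; apply: contrapT => nk; apply: bad; exists l.
  split; first by case/orP: yl => /eqP; auto.
  by right=> k; rewrite leNgt; apply/negP => lk; apply: nk; exists k.
have [l1 [l2 [l12 y1 y2]]] : exists l1 l2, [/\ l1 < l2, on (f x) l1 & on (f x) l2].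
  have y1 : on (f x) (f x).1 by rewrite /on eqxx.
  have y2 : on (f x) (f x).2 by rewrite /on eqxx orbT.
  by case: (ltgtP (f x).1 (f x).2) => // lt; [exists (f x).1, (f x).2 | exists (f x).2, (f x).1].
have between p q l : x p < l -> l < x q -> on (f x) l -> unblocked f [set p] [set q].
  by move=> pl lq yl; exists x, (x p), (x q), l; split=> // j /set1P ->.
(* Chosen at the outer sides, so that both facilities lie strictly between [i] and [k]. *)
have [i il1] := below _ y1; have [k l2k] := above _ y2.
have ik : i != k by apply: contraTneq il1 => ->; rewrite -leNgt; lra.
have [||||||j [ji jk Mk Mi]] := @dictator n (unblocked f) _ _ _ _ _ hn i k ik.
- by move=> P P' Q Q'; apply: unblockedS.
- exact: unblocked_adjacent sp ap.
- by move=> P Y Q; apply: unblocked_adjacent_right sp ap.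
- by move=> A B D Z; apply: unblocked_extend sp ap.
- by move=> A B D Z; apply: unblocked_extend_right sp ap.
- by apply: (between _ _ l1) => //; lra.
have part_of (a b c : 'I_n) : a != b -> a != c -> b != c ->
    part3 [set a] (~: [set a; b]) [set b] /\ part3 (~: [set a; b]) [set a] [set b].
  move=> ab ac bc; split; split; try by apply/set0Pn; eexists; rewrite inE.
  - by apply/set0Pn; exists c; rewrite !inE negb_or !(eq_sym c) ac bc.
  - move=> t; rewrite !inE; case: (eqVneq t a) => [->|_] /=; first by rewrite (negPf ab).
    by case: (t == b).
  - by apply/set0Pn; exists c; rewrite !inE negb_or !(eq_sym c) ac bc.
  - move=> t; rewrite !inE; case: (eqVneq t a) => [->|_] /=; first by rewrite (negPf ab).
    by case: (t == b).
have [jl2|l2j] := ltP (x j) l2.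
  have ki : k != i by rewrite eq_sym.
  have [_ P3] := part_of j k i jk ji ki.
  exact: (unblocked_adjacent sp ap P3 Mk (between _ _ _ jl2 l2k y2)).
have ij : i != j by rewrite eq_sym.
have [P3 _] := part_of i j k ij ik jk.
exact: (unblocked_adjacent_right sp ap P3 (between _ _ _ il1 (lt_le_trans l12 l2j) y1) Mi).
Qed.
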